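(* Let $\mathcal{G}$ be a nonzero Lie algebra over a field $\mathbb{F}$, and let $K$ be a subspace of $\mathcal{G}$ such that $$[K,K]=\{0\},\qquad K+[K,\mathcal{G}]\neq\mathcal{G}.$$ Let $\bar{K}$ be any subspace of $\mathcal{G}$ such that $\mathcal{G}=\bar{K}\oplus(K+[K,\mathcal{G}])$, let $T_0:\bar{K}\to K$ be any linear map, and define a linear transformation $T$ on $\mathcal{G}$ by $$T(u_1+u_2)=T_0(u_1)\qquad\text{for } u_1\in\bar{K},\ u_2\in K+[K,\mathcal{G}].$$ Then $T$ is a classical R-matrix on $\mathcal{G}$ satisfying $T([u,T(v)])=[u,T^2(v)]$ for all $u,v\in\mathcal{G}$, and the operation $$u\circ v=T([u,v])-[T(u),v]\qquad(u,v\in\mathcal{G})$$ defines a Novikov algebra over the Lie algebra $\mathcal{G}$.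
   Context: All vector spaces and algebras are over a field $\mathbb{F}$. For subspaces $A,B$ of a Lie algebra, $[A,B]$ denotes the linear span of all $[a,b]$ with $a\in A$, $b\in B$. A linear transformation $T$ on a Lie algebra $\mathcal{G}$ is called a classical R-matrix if $[T(u),T(v)]=T([T(u),v])+T([u,T(v)])$ for all $u,v\in\mathcal{G}$. A Novikov algebra is a vector space $\mathcal{A}$ with a bilinear operation $\circ$ such that, for all $u,v,w\in\mathcal{A}$, (i) $(u\circ v)\circ w-u\circ(v\circ w)=(v\circ u)\circ w-v\circ(u\circ w)$, and (ii) $(u\circ v)\circ w=(u\circ w)\circ v$. A Gel'fand-Dorfman bialgebra is a vector space $\mathcal{A}$ with two operations $[\cdot,\cdot]$ and $\circ$ such that $(\mathcal{A},[\cdot,\cdot])$ is a Lie algebra, $(\mathcal{A},\circ)$ is a Novikov algebra, and $$[w,u]\circ v-[w,v]\circ u+[w\circ u,v]-[w\circ v,u]-w\circ[u,v]=0\qquad\text{for all } u,v,w\in\mathcal{A}.$$ In this case $(\mathcal{A},\circ)$ is called a Novikov algebra over the Lie algebra $(\mathcal{A},[\cdot,\cdot])$. *)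

(* Defs.v *)
From mathcomp Require Import all_boot all_order all_algebra.
From mathcomp Require Import sesquilinear.
From mathcomp Require Import boolp classical_sets functions.

Set Implicit Arguments.
Unset Strict Implicit.
Unset Printing Implicit Defensive.

Import GRing.Theory.
Local Open Scope classical_set_scope.
Local Open Scope ring_scope.

(* Subspaces are arbitrary sets closed under linear combinations, so that      *)
(* spaces of infinite dimension, where {vspace _} is unavailable, are covered. *)
Definition linear_subspace (F : fieldType) (V : lmodType F) (A : set V) : Prop :=
  submod_closed [in A].

Definition linear_span (F : fieldType) (V : lmodType F) (X : set V) : set V :=
  smallest (@linear_subspace F V) X.

Definition sumspace (F : fieldType) (V : lmodType F) (A B : set V) : set V :=
  [set a + b | a in A & b in B].

Definition is_direct_sum (F : fieldType) (V : lmodType F) (A B : set V) : Prop :=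
  sumspace A B = [set: V] /\ A `&` B = [set 0].

Definition linear_on (F : fieldType) (V W : lmodType F) (A : set V)
    (f : V -> W) : Prop :=
  forall a : F, {in A &, forall u v, f (a *: u + v) = a *: f u + f v}.

Definition is_lie_algebra (F : fieldType) (G : lmodType F)
    (br : G -> G -> G) : Prop :=
  [/\ bilinear_for *:%R *:%R br,
      forall u, br u u = 0 &
      forall u v w, br u (br v w) + br v (br w u) + br w (br u v) = 0].

Definition bracket_space (F : fieldType) (G : lmodType F) (br : G -> G -> G)
    (A B : set G) : set G :=
  linear_span [set br a b | a in A & b in B].

Definition classical_R_matrix (F : fieldType) (G : lmodType F)
    (br : G -> G -> G) (T : {linear G -> G}) : Prop :=
  forall u v, br (T u) (T v) = T (br (T u) v) + T (br u (T v)).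

Definition is_novikov_algebra (F : fieldType) (A : lmodType F)
    (op : A -> A -> A) : Prop :=
  [/\ bilinear_for *:%R *:%R op,
      forall u v w,
        op (op u v) w - op u (op v w) = op (op v u) w - op v (op u w) &
      forall u v w, op (op u v) w = op (op u w) v].

(* This is also what it means for [op] to be a Novikov algebra over [br]. *)
Definition is_gelfand_dorfman_bialgebra (F : fieldType) (A : lmodType F)
    (br op : A -> A -> A) : Prop :=
  [/\ is_lie_algebra br,
      is_novikov_algebra op &
      forall u v w,
        op (br w u) v - op (br w v) u + br (op w u) v - br (op w v) u
          - op w (br u v) = 0].

(* Main.v *)
From HB Require Import structures.
Require Import Defs.
From mathcomp Require Import all_boot all_order all_algebra.
From mathcomp Require Import boolp classical_sets functions.

Set Implicit Arguments.
Unset Strict Implicit.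
Unset Printing Implicit Defensive.

Import GRing.Theory.
Local Open Scope classical_set_scope.
Local Open Scope ring_scope.

(** Put [H = K + [K, G]].  The map [T] is [T0] composed with the projection
    onto [Kbar] along [H]; since a vector has only one decomposition along
    [Kbar] and [H], this map is linear and is the only one that satisfies the
    defining formula ([linear_extension]).  Its image lies in [K] and it kills
    [H].  Because [K] and [[K, G]] lie in [H] and [[K, K] = 0], this gives
    the three identities [T (T u) = 0], [T [u, T v] = 0] and [[T u, T v] = 0].
    They make both sides of the R-matrix identity, and of
    [T [u, T v] = [u, T (T v)]], vanish.

    The rest follows from these identities alone.  The Novikov operation
    [u o v = T [u, v] - [T u, v]] satisfies
    - [(u o v) o w = - T [[T u, v], w]], and
    - [u o (v o w) = [T u, [T v, w]] + T [[T v, u], w]],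
    so the associator is [- ([T u, [T v, w]] + T [[T u, v], w] +
    T [[T v, u], w])].  It is symmetric in [u] and [v] because
    [[T u, _]] and [[T v, _]] commute ([novikov_of_square_zero]).  The
    compatibility of [o] with the bracket is a consequence of the Jacobi
    identity for every linear [T] ([gelfand_dorfman_compat]). *)

(** * Identities in a Lie algebra *)

Lemma lieBl (F : fieldType) (G : lmodType F) (br : G -> G -> G) :
  is_lie_algebra br -> forall u v w, br (u - v) w = br u w - br v w.
Proof.
case=> -[brl _] _ _ u v w.
by have := brl w (-1) v u; rewrite /= !scaleN1r ![- _ + _]addrC.
Qed.

Lemma lieBr (F : fieldType) (G : lmodType F) (br : G -> G -> G) :
  is_lie_algebra br -> forall u v w, br u (v - w) = br u v - br u w.
Proof.
case=> -[_ brr] _ _ u v w.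
by have := brr u (-1) w v; rewrite /= !scaleN1r ![- _ + _]addrC.
Qed.

Lemma lie0l (F : fieldType) (G : lmodType F) (br : G -> G -> G) :
  is_lie_algebra br -> forall u, br 0 u = 0.
Proof. by move=> Glie u; rewrite -(subrr 0) (lieBl Glie) !subrr. Qed.

Lemma lie0r (F : fieldType) (G : lmodType F) (br : G -> G -> G) :
  is_lie_algebra br -> forall u, br u 0 = 0.
Proof. by move=> Glie u; rewrite -(subrr 0) (lieBr Glie) !subrr. Qed.

Lemma lieNl (F : fieldType) (G : lmodType F) (br : G -> G -> G) :
  is_lie_algebra br -> forall u v, br (- u) v = - br u v.
Proof. by move=> Glie u v; rewrite -sub0r (lieBl Glie) (lie0l Glie) sub0r. Qed.

Lemma lieC (F : fieldType) (G : lmodType F) (br : G -> G -> G) :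
  is_lie_algebra br -> forall u v, br u v = - br v u.
Proof.
move=> Glie u v; have [_ br_id _] := Glie; apply/eqP; rewrite -addr_eq0.
have := br_id (u - v).
rewrite (lieBl Glie) !(lieBr Glie) !br_id sub0r subr0 -opprD.
by move/eqP; rewrite oppr_eq0.
Qed.

(** The Jacobi identity as the derivation rule for [br w]; the second term
    is reversed by antisymmetry, so that only left-nested brackets occur. *)
Lemma lie_derivation (F : fieldType) (G : lmodType F) (br : G -> G -> G) :
  is_lie_algebra br ->
  forall w u v, br w (br u v) = br (br w u) v - br (br w v) u.
Proof.
move=> Glie w u v; have [_ _ jacobi] := Glie.
have /eqP := jacobi w u v; rewrite -addrA addr_eq0 => /eqP ->.
rewrite (lieC Glie u) (lieC Glie v (br w u)) (lieC Glie v w) (lieNl Glie).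
by rewrite opprD !opprK addrC.
Qed.

(** * The Novikov operation of a square-zero map *)

(** Once the terms containing a bracket inside [T] inside a bracket have
    cancelled in pairs, what is left is [T] of the Jacobi identity for
    [w, u, v] minus the Jacobi identity for [T w, u, v]. *)
Lemma gelfand_dorfman_compat (F : fieldType) (G : lmodType F)
    (br : G -> G -> G) (T : {linear G -> G})
    (op := fun u v => T (br u v) - br (T u) v) :
  is_lie_algebra br ->
  forall u v w, op (br w u) v - op (br w v) u + br (op w u) v - br (op w v) u
    - op w (br u v) = 0.
Proof.
move=> Glie u v w; rewrite /op !(lieBl Glie) !(lie_derivation Glie) (linearB T).
set a := T (br (br w u) v); set b := T (br (br w v) u).
set c := br (br (T w) u) v; set d := br (br (T w) v) u.
apply/eqP; rewrite subr_eq0; apply/eqP.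
(* [p] and [q] are the terms that cancel. *)
set p := br (T (br w u)) v; set q := br (T (br w v)) u.
rewrite (addrAC (a - p)) (addrA (a - p) p) subrK.
rewrite -[LHS]addrA -opprD (addrA (b - q) q) subrK.
by rewrite !opprD !opprK addrACA.
Qed.

(** The normal forms [opl] and [opr] of the two iterated products make the
    associator visibly symmetric.  Commutation of right multiplications is
    [T (br (br (T u) v) w) = T (br (br (T u) w) v)]: by Jacobi the difference
    is [T (br (T u) (br v w)) = 0]. *)
Lemma novikov_of_square_zero (F : fieldType) (G : lmodType F)
    (br : G -> G -> G) (T : {linear G -> G})
    (op := fun u v => T (br u v) - br (T u) v) :
  is_lie_algebra br ->
  (forall u, T (T u) = 0) ->
  (forall u v, T (br u (T v)) = 0) ->
  (forall u v, br (T u) (T v) = 0) ->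
  is_novikov_algebra op.
Proof.
move=> Glie TT0 TbrT0 brTT0; have [[brl brr] _ _] := Glie.
have TbrT0l u v : T (br (T u) v) = 0.
  by rewrite (lieC Glie) linearN TbrT0 oppr0.
have opl u v w : op (op u v) w = - T (br (br (T u) v) w).
  rewrite /op !linearB TT0 TbrT0l subrr (lie0l Glie) subr0.
  by rewrite (lieBl Glie) linearB TbrT0l sub0r.
have opr u v w :
    op u (op v w) = br (T u) (br (T v) w) + T (br (br (T v) u) w).
  rewrite /op !(lieBr Glie) linearB TbrT0 brTT0 !sub0r opprK addrC.
  rewrite (lie_derivation Glie u) linearB TbrT0 subr0.
  by rewrite (lieC Glie u) (lieNl Glie) linearN opprK.
split.
- split=> [v a u1 u2|u a v1 v2] /=; rewrite /op.
    by rewrite !(linearP T, brl v a) scalerBr opprD addrACA.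
  by rewrite !(brr _ a) linearP scalerBr opprD addrACA.
- move=> u v w; rewrite !opl !opr.
  (* [br (T u)] and [br (T v)] commute since [br (T v) (T u) = 0]. *)
  have -> : br (T v) (br (T u) w) = br (T u) (br (T v) w).
    by rewrite (lie_derivation Glie) brTT0 (lie0l Glie) sub0r -(lieC Glie).
  by rewrite !opprD addrCA [in RHS]addrCA (addrC (- T _)).
- move=> u v w; rewrite !opl; congr (- _).
  apply/eqP; rewrite -subr_eq0 -linearB.
  by rewrite -(lie_derivation Glie) TbrT0l.
Qed.

(** * Subspaces and direct sums *)

Lemma subspace0 (F : fieldType) (V : lmodType F) (A : set V) :
  linear_subspace A -> A 0.
Proof. by case=> + _; rewrite inE. Qed.

Lemma subspaceP (F : fieldType) (V : lmodType F) (A : set V) :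
  linear_subspace A ->
  forall (a : F) u v, A u -> A v -> A (a *: u + v).
Proof. by case=> _ Alin a u v Au Av; apply/set_mem/Alin; rewrite inE. Qed.

Lemma linear_span_subspace (F : fieldType) (V : lmodType F) (X : set V) :
  linear_subspace (linear_span X).
Proof.
split=> [|a u v]; first by rewrite inE => A [/subspace0].
rewrite !inE => Xu Xv A AX; have [Asub _] := AX.
by apply: (subspaceP Asub); [exact: Xu|exact: Xv].
Qed.

Lemma sumspace_subspace (F : fieldType) (V : lmodType F) (A B : set V) :
  linear_subspace A -> linear_subspace B -> linear_subspace (sumspace A B).
Proof.
move=> Asub Bsub; split=> [|c u v]; rewrite !inE.
  by exists 0; [exact: subspace0|exists 0; [exact: subspace0|rewrite addr0]].
move=> [a1 Aa1 [b1 Bb1 <-]] [a2 Aa2 [b2 Bb2 <-]].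
exists (c *: a1 + a2); first exact: subspaceP.
exists (c *: b1 + b2); first exact: subspaceP.
by rewrite scalerDr addrACA.
Qed.

Lemma sub_sumspacel (F : fieldType) (V : lmodType F) (A B : set V) :
  linear_subspace B -> A `<=` sumspace A B.
Proof.
move=> Bsub a Aa; exists a => //.
by exists 0; [exact: subspace0|rewrite addr0].
Qed.

Lemma sub_sumspacer (F : fieldType) (V : lmodType F) (A B : set V) :
  linear_subspace A -> B `<=` sumspace A B.
Proof.
move=> Asub b Bb; exists 0; first exact: subspace0.
by exists b => //; rewrite add0r.
Qed.

Lemma mem_bracket_space (F : fieldType) (G : lmodType F) (br : G -> G -> G)
    (A B : set G) a b : A a -> B b -> bracket_space br A B (br a b).
Proof. by move=> Aa Bb; apply: sub_gen_smallest; exists a => //; exists b. Qed.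

(** [a - a' = b' - b] lies in both summands. *)
Lemma direct_sum_inj (F : fieldType) (V : lmodType F) (A B : set V) :
  linear_subspace A -> linear_subspace B -> is_direct_sum A B ->
  forall a a' b b', A a -> A a' -> B b -> B b' -> a + b = a' + b' -> a = a'.
Proof.
move=> Asub Bsub [_ AB0] a a' b b' Aa Aa' Bb Bb' eq_ab.
suff : (A `&` B) (- 1 *: a' + a).
  by rewrite AB0 => /= /eqP; rewrite scaleN1r addrC subr_eq0 => /eqP.
split; first exact: subspaceP.
suff -> : - 1 *: a' + a = - 1 *: b + b' by exact: subspaceP.
rewrite !scaleN1r; apply: (addIr b).
by rewrite -addrA eq_ab addKr addrAC addNr add0r.
Qed.

(** The extension is the given map after the projection along [B]. *)
Lemma linear_extension (F : fieldType) (V W : lmodType F) (A B : set V)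
    (f : V -> W) :
  linear_subspace A -> linear_subspace B -> is_direct_sum A B ->
  linear_on A f ->
  exists T : {linear V -> W}, forall a b, A a -> B b -> T (a + b) = f a.
Proof.
move=> Asub Bsub AB flin.
have /choice[pr prP] x : exists a, A a /\ exists2 b, B b & a + b = x.
  have : [set: V] x by [].
  by rewrite -AB.1 => -[a Aa [b Bb <-]]; exists a; split=> //; exists b.
have prE a b : A a -> B b -> pr (a + b) = a.
  move=> Aa Bb; have [Ap [b' Bb' eq_ab]] := prP (a + b).
  exact: (direct_sum_inj Asub Bsub AB Ap Aa Bb' Bb).
have Tlin : linear (f \o pr).
  move=> c x y /=; have [Ax [b1 Bb1 {1}<-]] := prP x.
  have [Ay [b2 Bb2 {1}<-]] := prP y.
  rewrite scalerDr addrACA !prE //; try exact: subspaceP.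
  by rewrite flin// inE.
pose T : {linear V -> W} :=
  HB.pack (f \o pr) (GRing.isLinear.Build F V W _ (f \o pr) Tlin).
by exists T => a b Aa Bb /=; rewrite prE.
Qed.

(** * The R-matrix with abelian image *)

Theorem mainTheorem3 (F : fieldType) (G : lmodType F) (br : G -> G -> G)
    (G_lie : is_lie_algebra br) (G_neq0 : exists x : G, x != 0)
    (K : set G) (K_sub : linear_subspace K)
    (K_abelian : bracket_space br K K = [set 0])
    (K_proper : sumspace K (bracket_space br K [set: G]) <> [set: G])
    (Kbar : set G) (Kbar_sub : linear_subspace Kbar)
    (G_decomp : is_direct_sum Kbar (sumspace K (bracket_space br K [set: G])))
    (T0 : {fun Kbar >-> K}) (T0_linear : linear_on Kbar T0) :
  let defines_T (T : G -> G) :=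
    forall u1 u2, Kbar u1 -> sumspace K (bracket_space br K [set: G]) u2 ->
      T (u1 + u2) = T0 u1 in
  exists T : {linear G -> G},
    [/\ defines_T T,
        forall T' : G -> G, defines_T T' -> T' =1 T,
        classical_R_matrix br T,
        forall u v, T (br u (T v)) = br u (T (T v)) &
        is_gelfand_dorfman_bialgebra br
          (fun u v => T (br u v) - br (T u) v)].
Proof.
set H := sumspace K _ in G_decomp *; move=> defines_T.
have KG_sub : linear_subspace (bracket_space br K [set: G]).
  exact: linear_span_subspace.
have H_sub : linear_subspace H by exact: sumspace_subspace.
have [T TE] := linear_extension Kbar_sub H_sub G_decomp T0_linear.
have decomp x : exists a b, [/\ Kbar a, H b & x = a + b].
  have : [set: G] x by [].
  by rewrite -G_decomp.1 => -[a Ka [b Hb <-]]; exists a, b.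
have T_K x : K (T x).
  by have [a [b [Ka Hb ->]]] := decomp x; rewrite TE//; exact: funS.
have T_H b : H b -> T b = 0.
  move=> Hb; have Kbar0 := subspace0 Kbar_sub.
  rewrite -[b]add0r TE // -(TE 0 0) ?addr0 ?linear0 //; exact: subspace0.
have TT0 u : T (T u) = 0.
  by apply: T_H; apply: (sub_sumspacel KG_sub); exact: T_K.
have brTT0 u v : br (T u) (T v) = 0.
  have : bracket_space br K K (br (T u) (T v)).
    by apply: mem_bracket_space; exact: T_K.
  by rewrite K_abelian.
have TbrT0l u v : T (br (T u) v) = 0.
  apply: T_H; apply: (sub_sumspacer K_sub).
  by apply: mem_bracket_space => //; exact: T_K.
have TbrT0 u v : T (br u (T v)) = 0.
  by rewrite (lieC G_lie) linearN TbrT0l oppr0.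
exists T; split=> //.
- move=> T' T'E x; have [a [b [Ka Hb ->]]] := decomp x.
  by rewrite T'E // TE.
- by move=> u v; rewrite brTT0 TbrT0l TbrT0 addr0.
- by move=> u v; rewrite TT0 TbrT0 (lie0r G_lie).
- split=> //; first exact: novikov_of_square_zero.
  exact: gelfand_dorfman_compat.
Qed.
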